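(* Let $p$ be an odd prime and let $G$ be a quasi-powerful $p$-group. If $x,y\in G$ are such that $o(x)\le p^{i+1}$ and $o(y)\le p^{i}$ (for some integer $i\ge 0$), then $o([x^{p^{j}},y^{p^{k}}])\le p^{i-j-k}$ for all integers $j,k\ge 0$.
   Context: For an odd prime $p$, a finite $p$-group $G$ is powerful if $[G,G]\le G^{p}$, and $G$ is quasi-powerful if $G/Z(G)$ is powerful. $o(g)$ denotes the order of $g$. Convention: for an element $g$ of a $p$-group and an integer $m<0$, the inequality $o(g)\le p^{m}$ means $g=1$. *)

(* Defs.v *)
From mathcomp Require Import all_boot all_algebra all_fingroup all_solvable.
Set Implicit Arguments. Unset Strict Implicit. Unset Printing Implicit Defensive.
Import GroupScope.

(* For an odd prime p, a finite p-group G is powerful if [G,G] <= G^p,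
   where G^p = 'Mho^1(G) is the subgroup generated by the p-th powers. *)
Definition powerful (p : nat) (gT : finGroupType) (G : {set gT}) : bool :=
  [~: G, G] \subset 'Mho^1(G).

Definition quasi_powerful (p : nat) (gT : finGroupType) (G : {group gT}) : bool :=
  powerful p (G / 'Z(G)).

Definition order_le_pow (gT : finGroupType) (g : gT) (p : nat) (m : int) : Prop :=
  match m with
  | Posz n => (#[g] <= p ^ n)%N
  | Negz _ => g = 1
  end.

(* Main.v *)
Require Import Defs.
From mathcomp Require Import all_boot all_algebra all_fingroup all_solvable.
Import GroupScope.

(** Commutators only see elements modulo the center, so the orders of [x] and
    [y] may be replaced by their orders in [G / Z(G)]; this stronger form is
    what can be proved by induction.  Write [D n] for the subgroup generated by
    the [p^n]-th powers of [G' = [G, G]].  In a quasi-powerful group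
    [[D n, G] <= D (n + 1)], so every commutator
    [[x^(p^j), y^(p^k)]] lies in [D (j + k)], and each element of [D n] has the
    form [z^(p^(n + 1)) * w] with [w] central.

    The bound is proved by induction on [|G|] and, for a given [G], by
    descending induction on [i]: once [p^i] is at least [|G|] it follows from
    [[x^(p^j), y^(p^k)] \in D (j + k)].
    - For [j = k = 0], both factors of [[x, y] = (y^-1)^x * y] lie in
      [K = <y> G^p Z(G)], a powerful subgroup which is proper unless [G] is
      abelian.  By induction the bound holds in [K], which makes [g |-> g^(p^i)]
      multiplicative on the elements of [K] of order at most [p^i] modulo the
      center.
    - Raising one entry of the commutator to the power [p] lowers the order by
      a factor [p].  For [U = [X, Y]], the bound at [i + 1] applied to [p]-power
      roots (modulo the center) of [U] and of [[U, X]] shows that [<X, U>] has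
      class at most 2 modulo the elements of small order, whence
      [[X^p, Y] = X^-p (X U)^p = U^p] there. *)

Set Implicit Arguments.
Unset Strict Implicit.
Unset Printing Implicit Defensive.

(** * Congruences for powers and commutators modulo a normalized subgroup *)

(** Modulo [N] the commutator [[~ y, x]] commutes with [x] and [y], so the correction term in
    [(x * y) ^+ p] is its power with exponent ['C(p, 2)], a multiple of the odd [p]. *)
Lemma expMg_mod (p : nat) (gT : finGroupType) (N : {group gT}) (x y : gT) :
    odd p -> x \in 'N(N) -> y \in 'N(N) ->
    [~ y, x] ^+ p \in N -> [~ y, x, x] \in N -> [~ y, x, y] \in N ->
  exists2 n, n \in N & (x * y) ^+ p = x ^+ p * y ^+ p * n.
Proof.
move=> oddp nNx nNy cp cx cy.
exists ((x ^+ p * y ^+ p)^-1 * (x * y) ^+ p); last by rewrite mulKVg.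
have nNc : [~ y, x] \in 'N(N) by rewrite groupR.
apply: coset_idr; first by rewrite !(groupM, groupV, groupX).
rewrite !(morphM, morphV, morphX) ?(groupM, groupV, groupX) //=.
have comm_coset z : z \in 'N(N) -> [~ y, x, z] \in N ->
    commute (coset N z) [~ coset N y, coset N x].
  move=> nNz cz; apply/esym/commgP.
  by rewrite -!morphR //= coset_id.
rewrite expMg_Rmul; try exact: comm_coset.
have cosetp : [~ coset N y, coset N x] ^+ p = 1.
  by rewrite -morphR // -morphX //= coset_id.
by rewrite bin2odd // expgM cosetp expg1n mulg1 mulVg.
Qed.

Lemma commXg_mod (p : nat) (gT : finGroupType) (N : {group gT}) (x y : gT) :
    odd p -> x \in 'N(N) -> y \in 'N(N) ->
    [~ x, y] ^+ p \in N -> [~ x, y, x] ^+ p \in N ->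
    [~ x, y, x, x] \in N -> [~ x, y, x, [~ x, y]] \in N ->
  [~ x ^+ p, y] \in N.
Proof.
move=> oddp nNx nNy Nu Nv Nvx Nvu.
have nNu : [~ x, y] \in 'N(N) by rewrite groupR.
have [n Nn def] := expMg_mod oddp nNx nNu Nv Nvx Nvu.
by rewrite commgEl conjXg conjg_mulR def -mulgA mulKg groupM.
Qed.

(** In the nilpotent group [G / M], a subgroup contained in its own commutator with the whole group
    is trivial; this applies to [L / M]. *)
Lemma comm_sub_nil (gT : finGroupType) (G L M : {group gT}) :
    nilpotent G -> L <| G -> M <| G -> L \subset M <*> [~: L, G] ->
  L \subset M.
Proof.
move=> nilG /andP[sLG nLG] /andP[sMG nMG] sL.
have nML := subset_trans sLG nMG.
rewrite -quotient_sub1 //; apply/trivgP/eqP.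
have nilQ : nilpotent (G / M) by apply: quotient_nil.
have /forall_inP/(_ (L / M)%G)-> //= := nilQ.
rewrite subsetI quotientS //= -quotientR //.
have nMR : [~: L, G] \subset 'N(M).
  by rewrite (subset_trans (commg_sub _ _)) // join_subG nML.
by rewrite quotientSK // -norm_joinEr.
Qed.

Lemma Mho1_sub (p : nat) (gT : finGroupType) (G H : {group gT}) :
  p.-group G -> (forall x, x \in G -> x ^+ p \in H) -> 'Mho^1(G) \subset H.
Proof.
move=> pG sH; rewrite (MhoE _ pG) gen_subG; apply/subsetP=> _ /imsetP[x Gx ->].
by rewrite expn1 sH.
Qed.

Lemma mem_Mho (p n : nat) (gT : finGroupType) (G : {group gT}) (x : gT) :
  p.-group G -> x \in G -> x ^+ (p ^ n) \in 'Mho^n(G).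
Proof. by move=> pG Gx; rewrite Mho_p_elt ?(mem_p_elt pG). Qed.

Lemma mem_Mho1 (p : nat) (gT : finGroupType) (G : {group gT}) (x : gT) :
  p.-group G -> x \in G -> x ^+ p \in 'Mho^1(G).
Proof. exact: (@mem_Mho p 1). Qed.

(* For x in N and g in G, modulo the right-hand side, u = [x, g] and
   v = [u, x] have exponent p and v is central, so that [x^p, g] = 1. *)
Lemma commg_Mho1_sub (p : nat) (gT : finGroupType) (G N R : {group gT}) :
    odd p -> p.-group G -> N <| G -> R <| G -> [~: N, G] \subset R ->
  [~: 'Mho^1(N), G] \subset 'Mho^1(R) <*> [~: [~: R, G], G].
Proof.
move=> oddp pG nsNG nsRG sNR.
have [sNG nNG] := andP nsNG; have [sRG nRG] := andP nsRG.
set W := _ <*> _.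
have nWG : G \subset 'N(W).
  by rewrite normsY ?normsR ?normG ?gFnorm_trans.
have sRGR : [~: R, G] \subset R by rewrite commg_subl.
have nWMho : 'Mho^1(N) \subset 'N(W) by rewrite !gFsub_trans ?(subset_trans sNG).
rewrite -quotient_cents2 // sub_quotient_pre //.
apply: (@Mho1_sub p _ N (coset W @*^-1 'C(G / W))%G); first exact: pgroupS pG.
move=> x Nx; have Gx := subsetP sNG x Nx.
have nWx := subsetP nWG x Gx.
apply/morphpreP; split; first exact: groupX.
apply/centP=> _ /morphimP[g nWg Gg ->].
apply/commgP; rewrite -morphR ?groupX //= coset_id //.
have Ru : [~ x, g] \in R by rewrite (subsetP sNR) ?mem_commg.
have Rv : [~ x, g, x] \in [~: R, G] by rewrite mem_commg.
have Wp z : z \in R -> z ^+ p \in W.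
  by move=> Rz; rewrite mem_gen // inE mem_Mho1 ?(pgroupS sRG pG).
have Wc z h : z \in [~: R, G] -> h \in G -> [~ z, h] \in W.
  by move=> Rz Gh; rewrite mem_gen // inE orbC mem_commg.
have Gu := subsetP sRG _ Ru.
by apply: (@commXg_mod p); rewrite ?(subsetP nWG) ?Wc ?Wp // (subsetP sRGR).
Qed.

(** The extra term [[R, G, G]] of [commg_Mho1_sub] lies in [[L, G]] for [L = [~: 'Mho^1(N), G]], so
    [comm_sub_nil] discards it. *)
Lemma commg_Mho1_sub_Mho1 (p : nat) (gT : finGroupType) (G N R : {group gT}) :
    odd p -> p.-group G -> N <| G -> R <| G -> [~: N, G] \subset R ->
    [~: R, G] \subset [~: 'Mho^1(N), G] ->
  [~: 'Mho^1(N), G] \subset 'Mho^1(R).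
Proof.
move=> oddp pG nsNG nsRG sNR sRN.
have nsMN : 'Mho^1(N) <| G by apply: gFnormal_trans.
have nsMR : 'Mho^1(R) <| G by apply: gFnormal_trans.
apply: (@comm_sub_nil _ G [~: 'Mho^1(N), G]%G 'Mho^1(R)%G) => //=.
- exact: pgroup_nil pG.
- rewrite /normal normsR ?normG ?normal_norm // andbT.
  by apply: subset_trans (normal_sub nsMN); rewrite commg_subl normal_norm.
apply: subset_trans (commg_Mho1_sub oddp pG nsNG nsRG sNR) _.
by rewrite genS // setUS // commSg.
Qed.

(* Quasi-powerfulness without quotients; the prime is implicit in 'Mho^1. *)
Definition center_powerful (gT : finGroupType) (G : {group gT}) : bool :=
  [~: G, G] \subset 'Mho^1(G) <*> 'Z(G).

(** The subgroup [K] of the induction on [#|G|]; [y = 1] gives [G^p Z(G)]. *)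
Definition cycle_ext (gT : finGroupType) (G : {group gT}) (y : gT) : {group gT} :=
  (<[y]> <*> ('Mho^1(G) <*> 'Z(G)))%G.

(** * Center-powerful groups and the subgroups [cycle_ext G y] *)

Section CenterPowerful.

Variables (p : nat) (gT : finGroupType) (G : {group gT}).
Hypotheses (oddp : odd p) (pG : p.-group G) (qG : center_powerful G).

Lemma commg_Mho1_center :
  [~: 'Mho^1(G) <*> 'Z(G), G] \subset [~: 'Mho^1(G), G].
Proof.
have cZG : 'Z(G) \subset 'C(G) by apply: subsetIr.
rewrite norm_joinEr; last first.
  by rewrite cents_norm // centsC (subset_trans (gFsub _ _)) // centsC.
rewrite commMG.
  by rewrite (commG1P cZG) mulg1.
by rewrite (subset_trans (center_sub G)) ?normsR ?normG ?gFnorm.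
Qed.

Lemma commg_Mho1_der1 : [~: 'Mho^1(G), G] \subset 'Mho^1([~: G, G]).
Proof.
apply: (@commg_Mho1_sub_Mho1 p _ G G [~: G, G]%G) => //.
- exact: (der_normal 1).
- exact: subset_trans (commSg _ qG) commg_Mho1_center.
Qed.

Lemma commg_der1_Mho1 : [~: [~: G, G], G] \subset 'Mho^1([~: G, G]).
Proof.
apply: subset_trans (commSg _ qG) _.
exact: subset_trans commg_Mho1_center commg_Mho1_der1.
Qed.

Lemma der1_cycle_ext y : [~: G, G] \subset cycle_ext G y.
Proof. by rewrite (subset_trans qG) // joing_subr. Qed.

Lemma center_cycle_ext y : 'Z(G) \subset cycle_ext G y.
Proof. by rewrite /= joingA joing_subr. Qed.

Lemma mem_cycle_ext y : y \in cycle_ext G y.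
Proof. by rewrite (subsetP (joing_subl _ _)) ?cycle_id. Qed.

Lemma cycle_ext_sub y : y \in G -> cycle_ext G y \subset G.
Proof. by move=> Gy; rewrite /= !join_subG cycle_subG Gy Mho_sub center_sub. Qed.

(** Modulo [D], [G^p Z(G)] is central in [G], so the image of [K] is generated by one element and a
    central subgroup. *)
Lemma commg_cycle_ext y : y \in G ->
  [~: cycle_ext G y, cycle_ext G y] \subset 'Mho^1([~: G, G]).
Proof.
move=> Gy; set D := 'Mho^1(_); set K := cycle_ext G y.
have sKG : K \subset G by apply: cycle_ext_sub.
have nDG : G \subset 'N(D) by rewrite gFnorm_trans ?(der_norm 1).
have nDK := subset_trans sKG nDG.
rewrite -quotient_cents2 //.
have sMG : 'Mho^1(G) <*> 'Z(G) \subset G by rewrite join_subG Mho_sub center_sub.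
have cMG : ('Mho^1(G) <*> 'Z(G)) / D \subset 'C(G / D).
  rewrite quotient_cents2 ?(subset_trans sMG) //.
  exact: subset_trans commg_Mho1_center commg_Mho1_der1.
have defK : K / D = <[coset D y]> <*> (('Mho^1(G) <*> 'Z(G)) / D).
  rewrite quotientY ?cycle_subG ?(subsetP nDG) ?(subset_trans sMG) //.
  by rewrite quotient_cycle ?(subsetP nDG).
have cKM : K / D \subset 'C(('Mho^1(G) <*> 'Z(G)) / D).
  by rewrite centsC (subset_trans cMG) // centS // quotientS.
rewrite {1}defK join_subG centsC.
apply/andP; split; last by rewrite centsC.
rewrite defK join_subG cents_cycle //=.
by rewrite (subset_trans cMG) // centS // cycle_subG mem_quotient.
Qed.

Lemma commg_cycle_ext_Mho1 y : y \in G ->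
  [~: cycle_ext G y, cycle_ext G y] \subset 'Mho^1(cycle_ext G y).
Proof.
by move=> Gy; rewrite (subset_trans (commg_cycle_ext Gy)) ?MhoS ?der1_cycle_ext.
Qed.

Lemma center_powerful_cycle_ext y : y \in G -> center_powerful (cycle_ext G y).
Proof.
move=> Gy; rewrite /center_powerful (subset_trans (commg_cycle_ext_Mho1 Gy)) //.
exact: joing_subl.
Qed.

Lemma cycle_ext_proper y : y \in G -> ~~ abelian G -> cycle_ext G y \proper G.
Proof.
move=> Gy; apply: contraR; rewrite properE cycle_ext_sub //= negbK => sGK.
have defG : <[y]> <*> 'Z(G) = G.
  rewrite -[<[y]> <*> _]genGid; apply: Phi_nongen.
  apply/eqP; rewrite eqEsubset !join_subG Phi_sub cycle_subG Gy center_sub /=.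
  apply: subset_trans sGK _; rewrite (Phi_joing pG) join_subG join_subG.
  have sPhi := joing_subl (G^`(1) <*> 'Mho^1(G)) (<[y]> <*> 'Z(G)).
  have sYZ := joing_subr (G^`(1) <*> 'Mho^1(G)) (<[y]> <*> 'Z(G)).
  apply/and3P; split.
  - exact: subset_trans (joing_subl _ _) sYZ.
  - exact: subset_trans (joing_subr _ _) sPhi.
  - exact: subset_trans (joing_subr _ _) sYZ.
rewrite -defG abelianY cycle_abelian center_abelian.
by rewrite /= (subset_trans (subsetIr G _)) // centS // cycle_subG.
Qed.

End CenterPowerful.

(* Modulo the p-th powers of G' the p-power map is multiplicative, so g = a^p c
   with c in 'Mho^1(G'); both factors are in 'Mho^1(K) for K = <a> G^p Z(G). *)
Lemma Mho1_root (p : nat) (gT : finGroupType) (G : {group gT}) (g : gT) :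
    odd p -> p.-group G -> center_powerful G -> g \in 'Mho^1(G) ->
  exists2 z, z \in G & g = z ^+ p.
Proof.
move=> oddp; have [n] := ubnP #|G|; elim: n => // n IHn in G g *.
move=> leGn pG qG.
set D := 'Mho^1([~: G, G])%G.
have sG'G : [~: G, G] \subset G by apply: (der_sub 1).
have nDG : G \subset 'N(D) by rewrite gFnorm_trans ?(der_norm 1).
have sDG : D \subset G := subset_trans (Mho_sub _ _) sG'G.
have D_comm u x : u \in [~: G, G] -> x \in G -> [~ u, x] \in D.
  by move=> G'u Gx; rewrite (subsetP (commg_der1_Mho1 oddp pG qG)) ?mem_commg.
(* Once a subgroup, this set contains ['Mho^1(G)], since it contains every p-th power. *)
have group_pow : group_set ([set x ^+ p | x in G] * D).
  apply/group_setP; split.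
    apply/mulsgP; exists 1 1; rewrite ?mulg1 //.
    by apply/imsetP; exists 1; rewrite ?expg1n.
  move=> _ _ /mulsgP[_ c /imsetP[a Ga ->] Dc ->] /mulsgP[_ d /imsetP[b Gb ->] Dd ->].
  have G'u : [~ b, a] \in [~: G, G] by rewrite mem_commg.
  have [e De def_ab] : exists2 e, e \in D & (a * b) ^+ p = a ^+ p * b ^+ p * e.
    apply: expMg_mod; rewrite ?(subsetP nDG) ?D_comm //.
    by rewrite mem_Mho1 ?(pgroupS sG'G).
  apply/mulsgP; exists ((a * b) ^+ p) (e^-1 * (c ^ (b ^+ p) * d)).
  - by apply/imsetP; exists (a * b); rewrite ?groupM.
  - rewrite groupM ?groupV // groupM //.
    by rewrite memJ_norm // (subsetP nDG) ?groupX.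
  - by rewrite def_ab conjgE !mulgA !mulgK.
have sMho : 'Mho^1(G) \subset group group_pow.
  apply: (Mho1_sub pG) => x Gx; apply/mulsgP; exists (x ^+ p) 1; rewrite ?mulg1 //.
  by apply/imsetP; exists x.
move/(subsetP sMho)=> /mulsgP[_ c /imsetP[a Ga ->] Dc ->].
have [abG | not_abG] := boolP (abelian G).
  exists a => //; suff -> : c = 1 by rewrite mulg1.
  by apply/set1gP; move: Dc; rewrite /= -derg1 (derG1P abG) Mho1.
have ltKG := cycle_ext_proper pG Ga not_abG.
have sKG := proper_sub ltKG; have pK := pgroupS sKG pG.
have qK := center_powerful_cycle_ext oddp pG qG Ga.
have [||z Kz ->] := IHn (cycle_ext G a) (a ^+ p * c) _ pK qK.
- exact: leq_trans (proper_card ltKG) _.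
- rewrite groupM //; first by rewrite mem_Mho1 ?mem_cycle_ext.
  by rewrite (subsetP (MhoS _ (der1_cycle_ext qG a))).
by exists z; rewrite ?(subsetP sKG).
Qed.

(** * Iterated powers of a powerfully embedded subgroup *)

Section PowerfullyEmbedded.

Variables (p : nat) (gT : finGroupType) (G N : {group gT}).
Hypotheses (oddp : odd p) (pG : p.-group G) (nsNG : N <| G).
Hypothesis peN : [~: N, G] \subset 'Mho^1(N).

Let sNG := normal_sub nsNG.
Let pN := pgroupS sNG pG.

(** The induction is joint: the embedding of ['Mho^n(N)] makes it center-powerful, so [Mho1_root]
    takes a further root, and [commg_Mho1_sub_Mho1] carries the embedding to the next power. *)
Lemma Mho_embedded n :
  [/\ forall u, u \in 'Mho^n(N) -> exists2 t, t \in N & u = t ^+ (p ^ n),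
      'Mho^1('Mho^n(N)) = 'Mho^n.+1(N)
    & [~: 'Mho^n(N), G] \subset 'Mho^n.+1(N)].
Proof.
have MhoSn m : (forall u, u \in 'Mho^m(N) -> exists2 t, t \in N & u = t ^+ (p ^ m)) ->
    'Mho^1('Mho^m(N)) = 'Mho^m.+1(N).
  have pM : p.-group 'Mho^m(N) by apply: pgroupS (Mho_sub m N) pN.
  move=> root; apply/eqP; rewrite eqEsubset; apply/andP; split.
    apply: (Mho1_sub pM) => _ /root[t Nt ->].
    by rewrite -expgM -expnSr mem_Mho.
  rewrite (MhoE _ pN) gen_subG; apply/subsetP=> _ /imsetP[x Nx ->].
  by rewrite expnSr expgM !(mem_Mho1, mem_Mho).
elim: n => [|n [root defM peM]].
  have root u : u \in 'Mho^0(N) -> exists2 t, t \in N & u = t ^+ (p ^ 0).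
    by rewrite Mho0 => Nu; exists u.
  by split; rewrite ?MhoSn // Mho0.
have nsM m : 'Mho^m(N) <| G by apply: gFnormal_trans.
have peSn : [~: 'Mho^n.+1(N), G] \subset 'Mho^1('Mho^n.+1(N)).
  rewrite -{1}defM; apply: (@commg_Mho1_sub_Mho1 p _ G 'Mho^n(N)%G 'Mho^n.+1(N)%G) => //=.
  by rewrite defM.
have rootSn u : u \in 'Mho^n.+1(N) -> exists2 t, t \in N & u = t ^+ (p ^ n.+1).
  rewrite -defM => Mu.
  have pM : p.-group 'Mho^n(N) by apply: pgroupS (Mho_sub n N) pN.
  have qM : center_powerful 'Mho^n(N)%G.
    rewrite /center_powerful defM (subset_trans (commgS _ (normal_sub (nsM n)))) //.
    by rewrite (subset_trans peM) ?joing_subl.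
  have [z /root[t Nt ->] ->] := Mho1_root oddp pM qM Mu.
  by exists t; rewrite // -expgM -expnSr.
have defSn := MhoSn _ rootSn.
by split; rewrite // -defSn.
Qed.

End PowerfullyEmbedded.

Lemma expg_pexp_le (p a b : nat) (gT : finGroupType) (H : {group gT}) (x : gT) :
  (a <= b)%N -> x ^+ (p ^ a) \in H -> x ^+ (p ^ b) \in H.
Proof. by move=> leab Hx; rewrite -(subnKC leab) expnD expgM groupX. Qed.

Lemma expg_pexp_le1 (p a b : nat) (gT : finGroupType) (x : gT) :
  (a <= b)%N -> x ^+ (p ^ a) = 1 -> x ^+ (p ^ b) = 1.
Proof. by move=> leab x1; apply/set1gP/(expg_pexp_le leab)/set1gP. Qed.

Lemma commMg_center (gT : finGroupType) (G : {group gT}) (x w y : gT) :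
  x \in G -> w \in 'Z(G) -> y \in G -> [~ x * w, y] = [~ x, y].
Proof.
move=> Gx /centerP[Gw cGw] Gy; rewrite commMgJ.
have -> : [~ w, y] = 1 by apply/eqP/commgP/cGw.
by rewrite mulg1 conjgE -cGw ?groupR // mulKg.
Qed.

Lemma commgM_center (gT : finGroupType) (G : {group gT}) (x y w : gT) :
  x \in G -> y \in G -> w \in 'Z(G) -> [~ x, y * w] = [~ x, y].
Proof.
by move=> Gx Gy Zw; rewrite -invg_comm (commMg_center Gy Zw Gx) invg_comm.
Qed.

(** As [w] is central, [x ^+ (q * r)] is the inverse of [w ^+ r]. This bounds the order modulo the
    center of a root of a commutator. *)
Lemma expg_center (gT : finGroupType) (G : {group gT}) (x w : gT) (q r : nat) :
    x \in G -> w \in 'Z(G) -> (x ^+ q * w) ^+ r = 1 -> x ^+ (q * r) \in 'Z(G).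
Proof.
move=> Gx Zw; have cxw : commute (x ^+ q) w.
  by case/centerP: Zw => _ cw; apply/commute_sym/cw; rewrite groupX.
rewrite expgMn // -expgM => /eqP; rewrite -eq_invg_mul eq_sym -eq_invg_sym.
by move/eqP <-; rewrite groupV groupX.
Qed.

(* Truncated subtraction: when [i < j + k] the bound says that the commutator is
   trivial, which is the paper's convention for negative exponents. *)
Definition comm_pow_bound (p : nat) (gT : finGroupType) (G : {group gT}) (i : nat) :=
  forall (x y : gT) (j k : nat), x \in G -> y \in G ->
    x ^+ (p ^ i.+1) \in 'Z(G) -> y ^+ (p ^ i) \in 'Z(G) ->
  [~ x ^+ (p ^ j), y ^+ (p ^ k)] ^+ (p ^ (i - (j + k))) = 1.

(** * Commutators and power maps in center-powerful groups *)

Section CenterPowerfulPowers.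

Variables (p : nat) (gT : finGroupType) (G : {group gT}).
Hypotheses (oddp : odd p) (pG : p.-group G) (qG : center_powerful G).

Lemma der1_pow_center u :
  u \in [~: G, G] -> exists z w, [/\ z \in G, w \in 'Z(G) & u = z ^+ p * w].
Proof.
move/(subsetP qG); rewrite /= norm_joinEr; last first.
  by rewrite cents_norm // (subset_trans (subsetIr _ _)) // centS // Mho_sub.
case/mulsgP=> g w Mg Zw ->.
by have [z Gz ->] := Mho1_root oddp pG qG Mg; exists z, w.
Qed.

Let embG' n := @Mho_embedded p gT G [~: G, G]%G oddp pG (der_normal 1 G)
  (commg_der1_Mho1 oddp pG qG) n.

Lemma commg_Mho_der1 n u x :
  u \in 'Mho^n([~: G, G]) -> x \in G -> [~ u, x] \in 'Mho^n.+1([~: G, G]).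
Proof.
by move=> Du Gx; case: (embG' n) => _ _ /subsetP; apply; apply: mem_commg.
Qed.

(** The [p^n]-th root lies in [[G, G]], hence is itself a p-th power modulo the center: this gives
    the exponent [n.+1]. *)
Lemma Mho_der1_root n u : u \in 'Mho^n([~: G, G]) ->
  exists z w, [/\ z \in G, w \in 'Z(G) & u = z ^+ (p ^ n.+1) * w].
Proof.
have [root _ _] := embG' n; case/root=> t /der1_pow_center[z [w [Gz Zw ->]]] ->.
exists z, (w ^+ (p ^ n)); rewrite groupX //; split=> //.
rewrite expgMn; first by rewrite -expgM -expnS.
by case/centerP: Zw => _ cw; apply/commute_sym/cw; rewrite groupX.
Qed.

(** A commutator in ['Mho^n] of [[G, G]] is central of exponent [p] modulo ['Mho^n.+1], so
    [commXg_mod] gains one index per p-th power of an entry. *)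
Lemma commXX_Mho_der1 x y j k : x \in G -> y \in G ->
  [~ x ^+ (p ^ j), y ^+ (p ^ k)] \in 'Mho^(j + k)([~: G, G]).
Proof.
move=> Gx Gy.
have sG'G : [~: G, G] \subset G by apply: (der_sub 1).
have step n a b : a \in G -> b \in G -> [~ a, b] \in 'Mho^n([~: G, G]) ->
    [~ a ^+ p, b] \in 'Mho^n.+1([~: G, G]).
  move=> Ga Gb Du.
  have nDG m : G \subset 'N('Mho^m([~: G, G])) by rewrite gFnorm_trans ?(der_norm 1).
  have sDG m : 'Mho^m([~: G, G]) \subset G by apply: subset_trans (Mho_sub _ _) sG'G.
  have Dv c : c \in G -> [~ a, b, c] \in 'Mho^n.+1([~: G, G]).
    by move=> Gc; apply: commg_Mho_der1.
  have Dvv c d : c \in G -> d \in G -> [~ a, b, c, d] \in 'Mho^n.+1([~: G, G]).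
    move=> Gc Gd; rewrite (subsetP (Mho_leq _ (leqnSn n.+1))) //.
    by rewrite commg_Mho_der1 ?Dv.
  have Gu : [~ a, b] \in G by rewrite groupR.
  apply: (@commXg_mod p _ 'Mho^n.+1([~: G, G])%G);
    rewrite ?(subsetP (nDG _)) ?Dvv ?(groupX _ (Dv _ _)) //.
  have [_ /= <- _] := embG' n.
  by rewrite mem_Mho1 // (pgroupS (sDG n)).
elim: j => [|j IHj]; last first.
  by rewrite expnSr expgM step ?groupX.
elim: k => [|k IHk]; first by rewrite Mho0 mem_commg ?groupX.
by rewrite addnS -groupV invg_comm expnSr expgM step ?groupX // -groupV invg_comm.
Qed.

Section Expg.

Hypothesis boundG : forall i, comm_pow_bound p G i.

Lemma expgM_center_pow i a b : a \in G -> b \in G ->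
    a ^+ (p ^ i) \in 'Z(G) -> b ^+ (p ^ i) \in 'Z(G) ->
  (a * b) ^+ (p ^ i) = a ^+ (p ^ i) * b ^+ (p ^ i).
Proof.
elim: i a b => [//|i IHi] a b Ga Gb Za Zb.
have group_N : group_set [set g in G | g ^+ (p ^ i) == 1].
  apply/group_setP; split=> [|g h]; first by rewrite !inE group1 expg1n /=.
  rewrite !inE => /andP[Gg /eqP g1] /andP[Gh /eqP h1].
  by rewrite groupM // IHi ?g1 ?h1 ?mulg1 /=.
pose N := group group_N.
have nNG : G \subset 'N(N).
  apply/subsetP=> g Gg; rewrite inE; apply/subsetP=> _ /imsetP[h Nh ->].
  move: Nh; rewrite !inE => /andP[Gh /eqP h1].
  by rewrite groupJ // -conjXg h1 conj1g /=.
have Nin g : g \in G -> g ^+ (p ^ i) = 1 -> g \in N.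
  by move=> Gg g1; rewrite !inE Gg g1 /=.
have Zba : [~ b, a] ^+ (p ^ i.+1) = 1.
  have := boundG 0 0 Gb Ga (expg_pexp_le (leqnSn _) Zb) Za.
  by rewrite subn0 !expg1.
have G'u : [~ b, a] \in [~: G, G] by rewrite mem_commg.
(* The root [z] may need exponent [p^(i+2)] to become central, one factor more than [c]; the
   asymmetry of [comm_pow_bound] allows this, and [j = 1] gives the factor back. *)
have [z [w [Gz Zw def_u]]] := der1_pow_center G'u.
have Zz : z ^+ (p ^ i.+2) \in 'Z(G).
  by rewrite expnS; apply: expg_center Gz Zw _; rewrite -def_u.
have Nu c : c \in G -> c ^+ (p ^ i.+1) \in 'Z(G) -> [~ b, a, c] \in N.
  move=> Gc Zc; apply: Nin; first by rewrite !groupR.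
  rewrite def_u (commMg_center (groupX _ Gz) Zw Gc).
  by have := boundG 1%N 0 Gz Gc Zz Zc; rewrite expn1 expg1 addn0 subn1.
have [n Nn ->] : exists2 n, n \in N &
    (a * b) ^+ (p ^ i.+1) = (a ^+ p * b ^+ p * n) ^+ (p ^ i).
  have [|||||n Nn def_ab] := @expMg_mod p gT N a b oddp.
  - exact: subsetP Ga.
  - exact: subsetP Gb.
  - by apply: Nin; rewrite ?groupX ?groupR // -expgM -expnS.
  - exact: Nu.
  - exact: Nu.
  by exists n; rewrite // expnS expgM def_ab.
move: Nn; rewrite inE => /andP[Gn /eqP n1].
have Zap : (a ^+ p) ^+ (p ^ i) \in 'Z(G) by rewrite -expgM -expnS.
have Zbp : (b ^+ p) ^+ (p ^ i) \in 'Z(G) by rewrite -expgM -expnS.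
have def_apbp := IHi _ _ (groupX p Ga) (groupX p Gb) Zap Zbp.
have Zapbp : (a ^+ p * b ^+ p) ^+ (p ^ i) \in 'Z(G) by rewrite def_apbp groupM.
have Zn : n ^+ (p ^ i) \in 'Z(G) by rewrite n1 group1.
rewrite (IHi _ _ (groupM (groupX p Ga) (groupX p Gb)) Gn Zapbp Zn) n1 def_apbp.
by rewrite mulg1 -!expgM -!expnS.
Qed.

End Expg.

End CenterPowerfulPowers.

(** * The two inductions for the commutator bound *)

(** This serves both entries of the commutator; [n] is the total exponent reached so far. *)
Lemma comm_pow_step (p : nat) (gT : finGroupType) (G : {group gT})
    (i n j : nat) (a y : gT) :
    odd p -> p.-group G -> center_powerful G ->
    comm_pow_bound p G i.+1 ->
    (forall c, comm_pow_bound p (cycle_ext G 1) c) ->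
    a \in G -> y \in G -> a ^+ (p ^ i.+1) \in 'Z(G) -> (n < i)%N -> (j <= n)%N ->
    [~ a ^+ (p ^ j), y] \in 'Mho^n([~: G, G]) ->
    [~ a ^+ (p ^ j), y] ^+ (p ^ (i - n)) = 1 ->
  [~ (a ^+ (p ^ j)) ^+ p, y] ^+ (p ^ (i - n.+1)) = 1.
Proof.
move=> oddp pG qG boundSi boundM Ga Gy Za lt_ni le_jn Du u1.
(* [M = G^p Z(G)] is normal, contains [[G, G]] and satisfies the bound, so its elements of order
   dividing [p^m] form a subgroup [N] normalized by [G]. *)
set M := cycle_ext G 1.
have sMG : M \subset G by apply: cycle_ext_sub.
have nMG : G \subset 'N(M).
  apply: (sub_der1_norm _ sMG); exact: (der1_cycle_ext qG).
have qM := center_powerful_cycle_ext oddp pG qG (group1 G).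
have sG'M : [~: G, G] \subset M by apply: der1_cycle_ext.
have def_m : (i - n)%N = (i - n.+1).+1 by rewrite subnSK.
set m := (i - n.+1)%N in def_m *.
have group_N : group_set [set g in M | g ^+ (p ^ m) == 1].
  apply/group_setP; split=> [|g h]; first by rewrite !inE group1 expg1n /=.
  rewrite !inE => /andP[Mg /eqP g1] /andP[Mh /eqP h1].
  rewrite groupM //.
  rewrite (expgM_center_pow oddp (pgroupS sMG pG) qM boundM Mg Mh) ?g1 ?h1 ?group1 //.
  by rewrite mulg1 /=.
pose N := group group_N.
have nNG g : g \in G -> g \in 'N(N).
  move=> Gg; rewrite inE; apply/subsetP=> _ /imsetP[h Nh ->].
  move: Nh; rewrite !inE => /andP[Mh /eqP h1].
  by rewrite memJ_norm ?(subsetP nMG) // Mh -conjXg h1 conj1g /=.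
have Nin c d : c \in G -> d \in G -> [~ c, d] ^+ (p ^ m) = 1 -> [~ c, d] \in N.
  by move=> Gc Gd c1; rewrite !inE c1 eqxx (subsetP sG'M) ?mem_commg.
set X := a ^+ (p ^ j) in Du u1 *; have GX : X \in G by rewrite groupX.
have Gu : [~ X, y] \in G by rewrite groupR.
(* With [u = [~ X, y]] and [v = [~ u, X]] written through the roots [z] and [z'], the bound at
   [i.+1] kills [v] at exponent [p^(m+1)], and [[~ v, X]] and [[~ v, u]] at [p^m]. *)
have [z [w [Gz Zw def_u]]] := Mho_der1_root oddp pG qG Du.
have [z' [w' [Gz' Zw' def_v]]] := Mho_der1_root oddp pG qG (commg_Mho_der1 oddp pG qG Du GX).
have v_eq : [~ X, y, X] = [~ z ^+ (p ^ n.+1), X].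
  by rewrite def_u (commMg_center (groupX _ Gz) Zw GX).
have Zz : z ^+ (p ^ i.+1) \in 'Z(G).
  have -> : (i.+1 = n.+1 + (i - n))%N by rewrite addSn subnKC // ltnW.
  by rewrite expnD; apply: expg_center Gz Zw _; rewrite -def_u.
have v1 : [~ X, y, X] ^+ (p ^ m.+1) = 1.
  rewrite v_eq; apply: expg_pexp_le1 (boundSi _ _ n.+1 j Gz Ga _ Za).
    by rewrite subSS -def_m leq_sub2l // leq_addr.
  exact: expg_pexp_le Zz.
have Zz' : z' ^+ (p ^ i.+2) \in 'Z(G).
  have -> : (i.+2 = n.+2 + m.+1)%N by rewrite -def_m !addSn subnKC // ltnW.
  by rewrite expnD; apply: expg_center Gz' Zw' _; rewrite -def_v.
have vX1 : [~ X, y, X, X] ^+ (p ^ m) = 1.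
  rewrite def_v (commMg_center (groupX _ Gz') Zw' GX).
  apply: expg_pexp_le1 (boundSi _ _ n.+2 j Gz' Ga Zz' Za).
  by rewrite subSS leq_sub2l // leq_addr.
have vu1 : [~ X, y, X, [~ X, y]] ^+ (p ^ m) = 1.
  rewrite {2}def_u def_v (commMg_center (groupX _ Gz') Zw') -?def_u //.
  rewrite def_u (commgM_center (groupX _ Gz') (groupX _ Gz) Zw).
  apply: expg_pexp_le1 (boundSi _ _ n.+2 n.+1 Gz' Gz Zz' Zz).
  by rewrite subSS leq_sub2l // leq_addr.
suff : [~ X ^+ p, y] \in N by rewrite inE => /andP[_ /eqP].
have NXp c d : c \in G -> d \in G -> [~ c, d] ^+ (p ^ m.+1) = 1 -> [~ c, d] ^+ p \in N.
  move=> Gc Gd c1; rewrite !inE -expgM -expnS c1 eqxx andbT.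
  by rewrite groupX // (subsetP sG'M) ?mem_commg.
by apply: (@commXg_mod p) => //; rewrite ?nNG ?NXp ?Nin ?groupR // -def_m.
Qed.

Lemma comm_pow_bound_base (p : nat) (gT : finGroupType) (G : {group gT}) (e i : nat) :
    odd p -> p.-group G -> center_powerful G -> #|G| = (p ^ e)%N -> (e <= i)%N ->
  comm_pow_bound p G i.
Proof.
move=> oddp pG qG oG le_ei x y j k Gx Gy _ _.
have sG'G : [~: G, G] \subset G by apply: (der_sub 1).
have [root _ _] := @Mho_embedded p gT G [~: G, G]%G oddp pG (der_normal 1 G)
  (commg_der1_Mho1 oddp pG qG) (j + k).
have [t G't ->] := root _ (commXX_Mho_der1 oddp pG qG j k Gx Gy).
(* The total exponent [j + k + (i - (j + k))] is the maximum of [j + k] and [i], hence at least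
   [e]. *)
rewrite -expgM -expnD; apply: (@expg_pexp_le1 p e).
  by rewrite (leq_trans le_ei) // -maxnE leq_maxr.
by rewrite -oG; apply: expg_cardG; apply: (subsetP sG'G).
Qed.

Lemma comm_pow_bound_descent (p : nat) (gT : finGroupType) (G : {group gT}) (i : nat) :
    odd p -> p.-group G -> center_powerful G ->
    (forall y c, y \in G -> comm_pow_bound p (cycle_ext G y) c) ->
    comm_pow_bound p G i.+1 ->
  comm_pow_bound p G i.
Proof.
move=> oddp pG qG boundK boundSi x y j k Gx Gy Zx Zy.
have boundM c := boundK 1 c (group1 G).
have comm1 : [~ x, y] ^+ (p ^ i) = 1.
  pose K := cycle_ext G y; have sKG : K \subset G := cycle_ext_sub Gy.
  have Ky : y \in K := mem_cycle_ext G y.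
  have Kyx : y ^ x \in K.
    rewrite conjg_mulR groupM // (subsetP (der1_cycle_ext qG y)) //.
    by rewrite mem_commg.
  have ZK : {subset 'Z(G) <= 'Z(K)}.
    move=> z Zz; case/centerP: (Zz) => _ cz.
    apply/centerP; split; first exact: (subsetP (center_cycle_ext G y)).
    by move=> h Kh; apply/cz/(subsetP sKG).
  (* So the factors [(y ^ x)^-1] and [y] of [[~ x, y]] have mutually inverse [p^i]-th powers. *)
  have yx_pow : (y ^ x) ^+ (p ^ i) = y ^+ (p ^ i).
    rewrite -conjXg; case/centerP: Zy => _ cy.
    by rewrite /conjg cy // mulKg.
  have Kyx' : (y ^ x)^-1 \in K by rewrite groupV.
  rewrite commgEr conjVg.
  rewrite (expgM_center_pow oddp (pgroupS sKG pG) (center_powerful_cycle_ext oddp pG qG Gy)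
    (fun c => boundK y c Gy) Kyx' Ky).
  - by rewrite expgVn yx_pow mulVg.
  - by rewrite expgVn yx_pow groupV ZK.
  - exact: ZK.
(* The exponent of [y] grows first, with the entries swapped by inverting the commutator; that of
   [x] follows. *)
have comm_y l : [~ x, y ^+ (p ^ l)] ^+ (p ^ (i - l)) = 1.
  elim: l => [|l IHl]; first by rewrite subn0.
  have [le_il | lt_li] := leqP i l.
    have Zyl : y ^+ (p ^ l.+1) \in 'Z(G) := expg_pexp_le (leqW le_il) Zy.
    suff -> : [~ x, y ^+ (p ^ l.+1)] = 1 by rewrite expg1n.
    by case/centerP: Zyl => _ cy; apply/eqP/commgP/commute_sym/cy.
  apply/eqP; rewrite -invg_comm expgVn eq_invg1 expnSr expgM; apply/eqP.
  apply: (comm_pow_step oddp pG qG boundSi boundM Gy Gx _ lt_li (leqnn l)).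
  - exact: expg_pexp_le Zy.
  - by have := commXX_Mho_der1 oddp pG qG l 0 Gy Gx; rewrite expg1 addn0.
  - by apply/eqP; rewrite -invg_comm expgVn eq_invg1 IHl.
elim: j => [|j IHj]; first by rewrite expg1 comm_y.
(* When [i <= j + k] the induction hypothesis already says that the commutator is trivial, and it
   stays so for further powers. *)
have [le_i | lt_i] := leqP i (j + k).
  move: IHj; rewrite (eqP (_ : i - (j + k) == 0)%N) // expn0 expg1 => c1.
  suff -> : [~ x ^+ (p ^ j.+1), y ^+ (p ^ k)] = 1 by rewrite expg1n.
  rewrite expnSr expgM; apply/eqP/commgP/commute_sym/commuteX/commute_sym.
  exact/commgP/eqP.
rewrite addSn expnSr expgM.
apply: (comm_pow_step oddp pG qG boundSi boundM Gx _ Zx lt_i (leq_addr k j)) => //.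
- by rewrite groupX.
- exact: (commXX_Mho_der1 oddp pG qG).
Qed.

Lemma center_powerful_comm_pow_bound (p : nat) (gT : finGroupType)
    (G : {group gT}) (i : nat) :
  odd p -> p.-group G -> center_powerful G -> comm_pow_bound p G i.
Proof.
move=> oddp; have [n] := ubnP #|G|; elim: n => // n IHn in G i * => leGn pG qG.
have [abG | not_abG] := boolP (abelian G).
  move=> x y j k Gx Gy _ _.
  suff -> : [~ x ^+ (p ^ j), y ^+ (p ^ k)] = 1 by rewrite expg1n.
  by apply/eqP/commgP; apply: (centsP abG); rewrite groupX.
have boundK y c : y \in G -> comm_pow_bound p (cycle_ext G y) c.
  move=> Gy; have ltKG := cycle_ext_proper pG Gy not_abG.
  apply: IHn; first exact: leq_trans (proper_card ltKG) _.
    exact: pgroupS (proper_sub ltKG) pG.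
  exact (center_powerful_cycle_ext oddp pG qG Gy).
have [e oG] := p_natP pG.
have [d] := ubnP (e - i); elim: d => // d IHd in i *.
have [le_ei _ | lt_ie le_d] := leqP e i; first exact: comm_pow_bound_base oG le_ei.
apply: comm_pow_bound_descent => //; apply: IHd.
by rewrite -ltnS (leq_trans _ le_d) // ltnS ltn_sub2l.
Qed.

Lemma quasi_powerful_center (p : nat) (gT : finGroupType) (G : {group gT}) :
  quasi_powerful p G -> center_powerful G.
Proof.
rewrite /quasi_powerful /powerful /center_powerful.
have nZG : G \subset 'N('Z(G)) by rewrite gFnorm.
have nZ (H : {set gT}) : H \subset G -> H \subset 'N('Z(G)).
  by move=> sHG; apply: subset_trans sHG nZG.
rewrite -quotientR // -(morphim_Mho 1 (coset_morphism _)) // quotientSK; last first.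
  by rewrite nZ // (der_sub 1).
by rewrite joingC norm_joinEr // nZ // Mho_sub.
Qed.

Unset Implicit Arguments.
Theorem theorem4 (p : nat) (gT : finGroupType) (G : {group gT}) (x y : gT) (i : nat) :
  prime p -> odd p -> p.-group G -> quasi_powerful p G ->
  x \in G -> y \in G ->
  (#[x] <= p ^ i.+1)%N -> (#[y] <= p ^ i)%N ->
  forall j k : nat,
    order_le_pow [~ x ^+ (p ^ j), y ^+ (p ^ k)] p (i%:Z - j%:Z - k%:Z)%R.
Proof.
move=> p_pr oddp pG /quasi_powerful_center qG Gx Gy ox oy j k.
have pow1 z m : z \in G -> (#[z] <= p ^ m)%N -> z ^+ (p ^ m) = 1.
  move=> Gz; have [s oz] := p_natP (mem_p_elt pG Gz).
  rewrite oz leq_exp2l ?prime_gt1 // => le_sm.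
  by apply: expg_pexp_le1 le_sm _; rewrite -oz expg_order.
have Zx : x ^+ (p ^ i.+1) \in 'Z(G) by rewrite pow1 ?group1.
have Zy : y ^+ (p ^ i) \in 'Z(G) by rewrite pow1 ?group1.
have := center_powerful_comm_pow_bound oddp pG qG j k Gx Gy Zx Zy.
set c := [~ _, _] => c1.
have -> : (i%:Z - j%:Z - k%:Z = i%:Z - (j + k)%:Z)%R.
  by rewrite PoszD GRing.opprD GRing.addrA.
(* The truncated difference is exact when [j + k <= i]; otherwise it is [0] and forces [c = 1]. *)
have [le_jk | lt_jk] := leqP (j + k) i.
  by rewrite subzn //= dvdn_leq ?expn_gt0 ?prime_gt0 // order_dvdn c1.
have c_eq1 : c = 1.
  by move: c1; rewrite (eqP (_ : i - (j + k) == 0)%N) ?expg1 // subn_eq0 ltnW.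
rewrite c_eq1; case: (_ - _)%R => //= m.
by rewrite order1 expn_gt0 prime_gt0.
Qed.
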